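(* Let $R_1,\dots,R_n$ be $G$-graded commutative rings, $R=R_1\times\cdots\times R_n$, let $M_i$ be a $G$-graded $R_i$-module for each $i$, $M=M_1\times\cdots\times M_n$ the corresponding graded $R$-module, and $s=(s_1,\dots,s_n)\in h^*(R)$. Assume that $N=N_1\times\cdots\times N_n$ is a graded $R$-submodule of $M$. Then $N\in GSpec_s({}_RM)$ if and only if there is some $i$ such that $N_i\in GSpec_{s_i}({}_{R_i}M_i)$ and $s_j\in(N_j:_{R_j}M_j)$ for all $j\neq i$.
   Context: $G$ is a group with identity $e$; rings are commutative with nonzero unity $1$ and modules are unital. A ring $R$ is $G$-graded if $R=\bigoplus_{g\in G}R_g$ with additive subgroups $R_g$ satisfying $R_gR_h\subseteq R_{gh}$; $h(R)=\bigcup_{g\in G}R_g$ and $h^*(R)=h(R)\setminus\{0\}$. An $R$-module $M$ is $G$-graded if $M=\bigoplus_{g\in G}M_g$ with additive subgroups $M_g$ satisfying $R_gM_h\subseteq M_{gh}$; $h(M)=\bigcup_{g\in G}M_g$. A submodule $N$ of $M$ is graded if $N=\bigoplus_{g\in G}(N\cap M_g)$. Products are graded componentwise: $(R_1\times\cdots\times R_n)_g=(R_1)_g\times\cdots\times(R_n)_g$ and $(M_1\times\cdots\times M_n)_g=(M_1)_g\times\cdots\times(M_n)_g$. Write $(N:_RM)=\{r\in R: rM\subseteq N\}$. For a nonzero homogeneous $s\in h^*(R)$, a graded $R$-submodule $N$ of $M$ is graded $s$-prime if $s\notin(N:_RM)$ and, for all $r\in h(R)$ and $m\in h(M)$, $rm\in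 N$ implies $sr\in(N:_RM)$ or $sm\in N$; $GSpec_s({}_RM)$ is the set of these (no submodule is graded $0$-prime, since $0\in(N:_RM)$). *)

(* Defs.v *)
From HB Require Import structures.
From mathcomp Require Import all_boot all_order all_algebra.
From mathcomp Require Import boolp classical_sets.

Set Implicit Arguments.
Unset Strict Implicit.
Unset Printing Implicit Defensive.

Import GRing.Theory.

Local Open Scope ring_scope.
Local Open Scope classical_set_scope.

Section Graded.
Variable G : groupType.

Section DirectSum.
Variable V : zmodType.

Definition additive_subgroup (A : set V) : Prop := zmod_closed [in A].

(* Internal direct sum decomposition [W = (+)_g A g]. [G] may be infinite, so
   sums range over duplicate-free finite sequences of degrees. *)
Definition direct_sum (W : set V) (A : G -> set V) : Prop :=
  [/\ forall g, additive_subgroup (A g) /\ A g `<=` W,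
      forall x, W x -> exists (t : seq G) (f : G -> V),
        [/\ uniq t, forall g, A g (f g) & x = \sum_(g <- t) f g]
    & forall (t : seq G) (f : G -> V), uniq t -> (forall g, A g (f g)) ->
        \sum_(g <- t) f g = 0 -> {in t, forall g, f g = 0}].

Definition homogeneous (A : G -> set V) : set V := \bigcup_g A g.

Definition nonzero_homogeneous (A : G -> set V) : set V :=
  homogeneous A `\ 0.

End DirectSum.

Definition graded_ring (R : comPzRingType) (Rg : G -> set R) : Prop :=
  direct_sum setT Rg /\
  forall g h (a b : R), Rg g a -> Rg h b -> Rg (g * h)%g (a * b).

Section Module.
Variables (R : comPzRingType) (Rg : G -> set R).
Variables (M : lmodType R) (Mg : G -> set M).

Definition graded_module : Prop :=
  direct_sum setT Mg /\
  forall g h (a : R) (m : M), Rg g a -> Mg h m -> Mg (g * h)%g (a *: m).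

Definition submodule (N : set M) : Prop := submod_closed [in N].

Definition graded_submodule (N : set M) : Prop :=
  submodule N /\ direct_sum N (fun g => N `&` Mg g).

Definition colon (N : set M) : set R := [set r | forall m : M, N (r *: m)].

Definition graded_prime_at (s : R) (N : set M) : Prop :=
  [/\ graded_submodule N, ~ colon N s
    & forall (r : R) (m : M), homogeneous Rg r -> homogeneous Mg m ->
        N (r *: m) -> colon N (s * r) \/ N (s *: m)].

(* [GSpec s] is empty unless [s] is a nonzero homogeneous element of [R]. *)
Definition GSpec (s : R) : set (set M) :=
  [set N | nonzero_homogeneous Rg s /\ graded_prime_at s N].

End Module.
End Graded.

(* The componentwise direct product of a finite family of rings; it is only a
   [comPzRingType] because it is the zero ring when [n = 0]. *)
Section ProductRing.
Variables (n : nat) (R : 'I_n -> comNzRingType).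

Definition prod_ring : Type := {dffun forall i : 'I_n, R i}.

HB.instance Definition _ := Choice.on prod_ring.

Implicit Types a b c : prod_ring.

Definition prod_ring_zero : prod_ring := [ffun i => 0 : R i].
Definition prod_ring_one : prod_ring := [ffun i => 1 : R i].
Definition prod_ring_opp a : prod_ring := [ffun i => - a i : R i].
Definition prod_ring_add a b : prod_ring := [ffun i => a i + b i : R i].
Definition prod_ring_mul a b : prod_ring := [ffun i => a i * b i : R i].

Fact prod_ring_addA : associative prod_ring_add.
Proof. by move=> a b c; apply/ffunP => i; rewrite !ffunE addrA. Qed.
Fact prod_ring_addC : commutative prod_ring_add.
Proof. by move=> a b; apply/ffunP => i; rewrite !ffunE addrC. Qed.
Fact prod_ring_add0 : left_id prod_ring_zero prod_ring_add.
Proof. by move=> a; apply/ffunP => i; rewrite !ffunE add0r. Qed.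
Fact prod_ring_addN : left_inverse prod_ring_zero prod_ring_opp prod_ring_add.
Proof. by move=> a; apply/ffunP => i; rewrite !ffunE addNr. Qed.

HB.instance Definition _ := GRing.isZmodule.Build prod_ring
  prod_ring_addA prod_ring_addC prod_ring_add0 prod_ring_addN.

Fact prod_ring_mulA : associative prod_ring_mul.
Proof. by move=> a b c; apply/ffunP => i; rewrite !ffunE mulrA. Qed.
Fact prod_ring_mulC : commutative prod_ring_mul.
Proof. by move=> a b; apply/ffunP => i; rewrite !ffunE mulrC. Qed.
Fact prod_ring_mul1 : left_id prod_ring_one prod_ring_mul.
Proof. by move=> a; apply/ffunP => i; rewrite !ffunE mul1r. Qed.
Fact prod_ring_mulD : left_distributive prod_ring_mul prod_ring_add.
Proof. by move=> a b c; apply/ffunP => i; rewrite !ffunE mulrDl. Qed.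

HB.instance Definition _ := GRing.Zmodule_isComPzRing.Build prod_ring
  prod_ring_mulA prod_ring_mulC prod_ring_mul1 prod_ring_mulD.

End ProductRing.

Section ProductModule.
Variables (n : nat) (R : 'I_n -> comNzRingType) (M : forall i, lmodType (R i)).

Definition prod_module : Type := {dffun forall i : 'I_n, M i}.

HB.instance Definition _ := Choice.on prod_module.

Implicit Types (a b : prod_ring R) (x y z : prod_module).

Definition prod_module_zero : prod_module := [ffun i => 0 : M i].
Definition prod_module_opp x : prod_module := [ffun i => - x i : M i].
Definition prod_module_add x y : prod_module := [ffun i => x i + y i : M i].
Definition prod_module_scale a x : prod_module := [ffun i => a i *: x i : M i].

Fact prod_module_addA : associative prod_module_add.
Proof. by move=> x y z; apply/ffunP => i; rewrite !ffunE addrA. Qed.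
Fact prod_module_addC : commutative prod_module_add.
Proof. by move=> x y; apply/ffunP => i; rewrite !ffunE addrC. Qed.
Fact prod_module_add0 : left_id prod_module_zero prod_module_add.
Proof. by move=> x; apply/ffunP => i; rewrite !ffunE add0r. Qed.
Fact prod_module_addN :
  left_inverse prod_module_zero prod_module_opp prod_module_add.
Proof. by move=> x; apply/ffunP => i; rewrite !ffunE addNr. Qed.

HB.instance Definition _ := GRing.isZmodule.Build prod_module
  prod_module_addA prod_module_addC prod_module_add0 prod_module_addN.

Fact prod_module_scaleA a b x :
  prod_module_scale a (prod_module_scale b x) = prod_module_scale (a * b) x.
Proof. by apply/ffunP => i; rewrite !ffunE scalerA. Qed.
Fact prod_module_scale1 : left_id 1 prod_module_scale.
Proof. by move=> x; apply/ffunP => i; rewrite !ffunE scale1r. Qed.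
Fact prod_module_scaleDr : right_distributive prod_module_scale +%R.
Proof. by move=> a x y; apply/ffunP => i; rewrite !ffunE scalerDr. Qed.
Fact prod_module_scaleDl x :
  {morph prod_module_scale^~ x : a b / a + b}.
Proof. by move=> a b; apply/ffunP => i; rewrite !ffunE scalerDl. Qed.

HB.instance Definition _ :=
  GRing.Zmodule_isLmodule.Build (prod_ring R) prod_module
    prod_module_scaleA prod_module_scale1
    prod_module_scaleDr prod_module_scaleDl.

Definition prod_set (N : forall i, set (M i)) : set prod_module :=
  [set x | forall i, N i (x i)].

End ProductModule.

Section ProductGrading.
Variables (G : groupType) (n : nat) (R : 'I_n -> comNzRingType).
Variable (M : forall i, lmodType (R i)).

Definition prod_ring_grading (Rg : forall i, G -> set (R i)) :
    G -> set (prod_ring R) :=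
  fun g => [set a | forall i, Rg i g (a i)].

Definition prod_module_grading (Mg : forall i, G -> set (M i)) :
    G -> set (prod_module M) :=
  fun g => prod_set (fun i => Mg i g).

End ProductGrading.

Section ProductGradingTheory.
Variables (G : groupType) (n : nat).

Lemma direct_sum_prod (V : zmodType) (W : 'I_n -> zmodType)
    (p : forall i, {additive V -> W i}) (q : (forall i, W i) -> V)
    (A : forall i, G -> set (W i)) :
  (forall w i, p i (q w) = w i) ->
  (forall x y, (forall i, p i x = p i y) -> x = y) ->
  (forall i, direct_sum setT (A i)) ->
  direct_sum setT (fun g => [set x | forall i, A i g (p i x)]).
Proof.
move=> pq p_inj dA; split.
- move=> g; split=> //; split=> [|x y].
    rewrite inE => i; have [/(_ g)[[+ _] _] _ _] := dA i.
    by rewrite raddf0 inE.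
  rewrite !inE => Ax Ay i; have [/(_ g)[[_ AB] _] _ _] := dA i.
  by have := AB _ _ (mem_set (Ax i)) (mem_set (Ay i)); rewrite -raddfB inE.
- move=> x _.
  have dec i : {tf : seq G * (G -> W i) |
      [/\ uniq tf.1, forall g, A i g (tf.2 g)
        & p i x = \sum_(g <- tf.1) tf.2 g]}.
    apply: cid; have [_ /(_ (p i x) I)[t [f [tu Af ->]]] _] := dA i.
    by exists (t, f).
  pose T i := (sval (dec i)).1; pose F i := (sval (dec i)).2.
  pose t := undup (flatten [seq T i | i <- enum 'I_n]).
  pose f g := q (fun i => if g \in T i then F i g else 0).
  exists t, f; split; first exact: undup_uniq.
    move=> g i; rewrite pq; have [_ AF _] := svalP (dec i).
    case: ifP => [_|_]; first exact: AF.
    by have [/(_ g)[[+ _] _] _ _] := dA i; rewrite inE.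
  apply: p_inj => i; rewrite raddf_sum.
  under eq_bigr do rewrite pq.
  rewrite -big_mkcond -big_filter /=.
  have [u _ ->] := svalP (dec i).
  apply: perm_big; apply: uniq_perm; rewrite ?filter_uniq ?undup_uniq //.
  move=> g; rewrite mem_filter mem_undup -/(T i).
  case: (boolP (g \in T i)) => //= gT; apply/esym/flattenP.
  by exists (T i) => //; apply: map_f; rewrite mem_enum.
- move=> t f tu Af sf g gt; apply: p_inj => i; rewrite raddf0.
  have [_ _ /(_ t (fun g => p i (f g)) tu)] := dA i.
  apply=> // [h|]; first exact: Af.
  by rewrite -[RHS](raddf0 (p i)) -sf raddf_sum.
Qed.

Lemma prod_ring_graded (R : 'I_n -> comNzRingType)
    (Rg : forall i, G -> set (R i)) :
  (forall i, graded_ring (Rg i)) -> graded_ring (prod_ring_grading Rg).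
Proof.
move=> gR; split; last first.
  by move=> g h a b Ra Rb i; rewrite ffunE; apply: (gR i).2.
have pB i : zmod_morphism (fun a : prod_ring R => a i).
  by move=> a b; rewrite !ffunE.
pose p i : {additive prod_ring R -> R i} :=
  HB.pack (fun a : prod_ring R => a i) (GRing.isZmodMorphism.Build _ _ _ (pB i)).
apply: (@direct_sum_prod _ _ p (fun w => [ffun i => w i])).
- by move=> w i; rewrite /= ffunE.
- by move=> a b ab; apply/ffunP.
- by move=> i; apply: (gR i).1.
Qed.

Lemma prod_module_graded (R : 'I_n -> comNzRingType)
    (M : forall i, lmodType (R i))
    (Rg : forall i, G -> set (R i)) (Mg : forall i, G -> set (M i)) :
  (forall i, graded_module (Rg i) (Mg i)) ->
  graded_module (prod_ring_grading Rg) (prod_module_grading Mg).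
Proof.
move=> gM; split; last first.
  by move=> g h a x Ra Mx i; rewrite ffunE; apply: (gM i).2.
have pB i : zmod_morphism (fun x : prod_module M => x i).
  by move=> x y; rewrite !ffunE.
pose p i : {additive prod_module M -> M i} :=
  HB.pack (fun x : prod_module M => x i) (GRing.isZmodMorphism.Build _ _ _ (pB i)).
apply: (@direct_sum_prod _ _ p (fun w => [ffun i => w i])).
- by move=> w i; rewrite /= ffunE.
- by move=> x y xy; apply/ffunP.
- by move=> i; apply: (gM i).1.
Qed.

End ProductGradingTheory.

(* Main.v *)
(* The nontrivial point of the direct implication is that [s] multiplies every
   component but one into the corresponding [N j]. If [s i] is not in the colon
   of [N i] and [m] is homogeneous and supported at [j != i], then every
   homogeneous [r] supported at [i] satisfies [r *: m = 0]. If [s *: m] were not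
   in [N], primality would put [s * r] in the colon of [N] for all these [r],
   and summing over the homogeneous components [r] of [1] would put [s i] in the
   colon of [N i]. *)
Require Import Defs.
From mathcomp Require Import all_boot all_order all_algebra.
From mathcomp Require Import boolp classical_sets.

Set Implicit Arguments.
Unset Strict Implicit.
Unset Printing Implicit Defensive.

Local Open Scope ring_scope.
Local Open Scope classical_set_scope.

Import GRing.Theory.

Section Submodule.
Variables (R : comPzRingType) (M : lmodType R) (N : set M).
Hypothesis subN : submodule N.

Lemma submodule0 : N 0.
Proof. by case: subN => /set_mem. Qed.

Lemma submoduleP a x y : N x -> N y -> N (a *: x + y).
Proof. by case: subN => _ NP /mem_set Nx /mem_set Ny; apply/set_mem/NP. Qed.

Lemma submodule_sum (I : eqType) (t : seq I) (F : I -> M) :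
  {in t, forall i, N (F i)} -> N (\sum_(i <- t) F i).
Proof.
move=> NF; rewrite big_seq; apply: (big_ind N) => // [|x y Nx Ny].
  exact: submodule0.
by rewrite -[x]scale1r; apply: submoduleP.
Qed.

End Submodule.

Section Single.
Variables (n : nat) (V : 'I_n -> nmodType).

Definition single i (x : V i) : {dffun forall j, V j} :=
  [ffun j => dfwith (fun k => 0 : V k) x j].

Lemma singleE i (x : V i) : single x i = x.
Proof. by rewrite ffunE dfwith_in. Qed.

Lemma single_neq i j (x : V i) : j != i -> single x j = 0.
Proof. by move=> ji; rewrite ffunE dfwith_out // eq_sym. Qed.

Lemma single_ind (P : forall j, V j -> Prop) i (x : V i) :
  (forall j, P j 0) -> P i x -> forall j, P j (single x j).
Proof. by move=> P0 Px j; rewrite ffunE; case: dfwithP. Qed.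

End Single.

Lemma direct_sum0 (G : groupType) (V : zmodType) (W : set V) (A : G -> set V)
    g :
  direct_sum W A -> A g 0.
Proof. by case=> /(_ g)[[/set_mem]]. Qed.

Section Product.
Variables (G : groupType) (n : nat) (R : 'I_n -> comNzRingType).
Variable M : forall i, lmodType (R i).
Implicit Types (Rg : forall i, G -> set (R i)).
Implicit Types (Mg : forall i, G -> set (M i)) (N : forall i, set (M i)).

(** The result types [prod_ring R] and [prod_module M] carry the componentwise ring and module
    structures, so [single] is restated at these types. *)
Definition single_ring i (a : R i) : prod_ring R := @single n R i a.
Definition single_module i (x : M i) : prod_module M := @single n M i x.

Lemma homogeneous_single_ring Rg i (a : R i) :
  (forall j, graded_ring (Rg j)) ->
  homogeneous (Rg i) a -> homogeneous (prod_ring_grading Rg) (single_ring a).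
Proof.
move=> hR [g _ Ra]; exists g => //.
apply: (single_ind (P := fun j => Rg j g)) Ra => j.
by have [dR _] := hR j; apply: direct_sum0 dR.
Qed.

Lemma homogeneous_single_module Rg Mg i (x : M i) :
  (forall j, graded_module (Rg j) (Mg j)) ->
  homogeneous (Mg i) x ->
  homogeneous (prod_module_grading Mg) (single_module x).
Proof.
move=> hM [g _ Mx]; exists g => //.
apply: (single_ind (P := fun j => Mg j g)) Mx => j.
by have [dM _] := hM j; apply: direct_sum0 dM.
Qed.

Lemma colon_prod N (a : prod_ring R) :
  (forall i, N i 0) ->
  colon (prod_set N) a <-> forall i, colon (N i) (a i).
Proof.
move=> N0; split=> [Na i x | Na x i]; last by rewrite ffunE; apply: Na.
by have := Na (single_module x) i; rewrite ffunE singleE.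
Qed.

(** An element of [N i], placed at index [i] with zeros elsewhere, lies in the product. Component
    [i] of its homogeneous decomposition there is a decomposition inside [N i]; independence is
    inherited from [M i]. *)
Lemma graded_submodule_prod Rg Mg N i :
  graded_module (Rg i) (Mg i) ->
  graded_submodule (prod_module_grading Mg) (prod_set N) ->
  graded_submodule (Mg i) (N i).
Proof.
move=> [[addM _ freeM] _] [subN [_ decN _]].
have N0 j : N j 0 by have := submodule0 subN j; rewrite ffunE.
have NS (x : M i) : N i x -> prod_set N (single_module x).
  by move=> Nx; apply: single_ind.
have subNi : submodule (N i).
  split=> [|a x y /set_mem Nx /set_mem Ny]; apply/mem_set=> //.
  have := submoduleP subN (single_ring a) (NS x Nx) (NS y Ny) i.
  by rewrite !ffunE !dfwith_in.
split=> //; split.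
- move=> g; split=> [|x []] //; have [[M0 MB] _] := addM g.
  split=> [|x y /set_mem[Nx Mx] /set_mem[Ny My]]; apply/mem_set.
    by split=> //; apply/set_mem: M0.
  split; last by apply/set_mem/MB; apply/mem_set.
  by rewrite addrC -scaleN1r; apply: submoduleP.
- move=> x /NS/decN[t [f [tu Nf xf]]]; exists t, (fun g => f g i); split=> //.
    by move=> g; have [] := Nf g; split.
  have {1}<- : single_module x i = x by apply: singleE.
  rewrite xf.
  by apply: (big_morph (fun y : prod_module M => y i)) => [y z|]; rewrite ffunE.
- by move=> t f tu Nf; apply: freeM => // g; have [] := Nf g.
Qed.

End Product.

Theorem proposition3p14 (G : groupType) (n : nat)
    (R : 'I_n -> comNzRingType) (Rg : forall i, G -> set (R i))
    (M : forall i, lmodType (R i)) (Mg : forall i, G -> set (M i))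
    (hR : forall i, graded_ring (Rg i))
    (hM : forall i, graded_module (Rg i) (Mg i))
    (s : prod_ring R)
    (hs : nonzero_homogeneous (prod_ring_grading Rg) s)
    (N : forall i, set (M i))
    (hN : graded_submodule (prod_module_grading Mg) (prod_set N)) :
  GSpec (prod_ring_grading Rg) (prod_module_grading Mg) s (prod_set N) <->
  exists i : 'I_n,
    GSpec (Rg i) (Mg i) (s i) (N i) /\
    forall j : 'I_n, j != i -> colon (N j) (s j).
Proof.
have subN : submodule (prod_set N) by case: hN.
have N0 i : N i 0 by have := submodule0 subN i; rewrite ffunE.
have hNi i : graded_submodule (Mg i) (N i) by apply: graded_submodule_prod (hM i) hN.
split=> [[_ [_ sN prN]] | [i [[_ [_ siN priN]] sjN]]]; last first.
  split=> //; split=> // [/colon_prod-/(_ N0 i) //|r m [g _ Rr] [h _ Mm] rmN].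
  (* Primality of [N i] selects the alternative. At each [j != i] both alternatives hold, since
     [s j] lies in the colon of [N j]. *)
  have := rmN i; rewrite ffunE => /(priN _ _ _ _).
  case=> [||sN|sN]; [by exists g | by exists h | left | right].
    apply/colon_prod => // j; rewrite ffunE.
    have [->//|/sjN sj x] := eqVneq j i.
    by rewrite -scalerA; apply: sj.
  by move=> j; rewrite ffunE; have [->//|/sjN] := eqVneq j i; apply.
have [i siN] : exists i, ~ colon (N i) (s i).
  by apply/existsNP => sNi; apply: sN; apply/colon_prod.
exists i; split.
  split.
    have [[g _ sg] _] := hs; split; first by exists g.
    (* [s i] is nonzero because 0 lies in every colon. *)
    by move=> s0; apply: siN => x; rewrite s0 scale0r.
  (* Primality of [N i] is primality of the product tested on elements supported at [i]. *)
  split=> // r m Rr Mm rmN.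
  have := prN _ _ (homogeneous_single_ring hR Rr)
    (homogeneous_single_module hM Mm).
  case=> [j|/colon_prod-/(_ N0 i)|/(_ i)]; rewrite !ffunE.
  - have [->|ji] := eqVneq j i; first by rewrite !dfwith_in.
    by rewrite !dfwith_out 1?eq_sym // scale0r.
  - by rewrite dfwith_in; left.
  - by rewrite dfwith_in; right.
move=> j ji x.
(* By linearity, [x] may be replaced by one of its homogeneous components [f g]. *)
have [[_ /(_ x I)[t [f [_ Mf ->]]] _] _] := hM j.
rewrite scaler_sumr; apply: submodule_sum => [|g _]; first by case: (hNi j).
apply: contrapT => sfN; apply: siN => y.
(* Writing 1 as the sum of the [r h] turns [s i *: y] into the sum of the [(s i * r h) *: y], each
   with a homogeneous [r h]. *)
have [[_ /(_ 1 I)[u [r [_ Rr r1]]] _] _] := hR i.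
rewrite -[s i]mulr1 r1 mulr_sumr scaler_suml.
apply: submodule_sum => [|h _]; first by case: (hNi i).
have Rh : homogeneous (Rg i) (r h) by exists h.
have Mh : homogeneous (Mg j) (f g) by exists g.
have := prN _ _ (homogeneous_single_ring hR Rh)
  (homogeneous_single_module hM Mh).
case=> [k|/colon_prod-/(_ N0 i)|/(_ j)].
(* The product vanishes at every [k]: the module factor is 0 at [k = i], the ring factor at
   [k != i]. *)
- rewrite ffunE; have [->|ki] := eqVneq k i.
    by rewrite /single_module [single (f g) i]single_neq ?scaler0 // eq_sym.
  by rewrite /single_ring [single (r h) k]single_neq // scale0r.
- by rewrite ffunE singleE; apply.
(* The second alternative contradicts [sfN]. *)
- by rewrite ffunE singleE.
Qed.
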